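(* Let $\{m_i\}_{i=1}^{\infty}$ and $\{n_j\}_{j=1}^{\infty}$ be sequences of real numbers with $0<m_1<m_2<\cdots$, $\sum_{i=1}^{\infty}1/m_i=\infty$, and $0<n_1<n_2<\cdots$, $\sum_{j=1}^{\infty}1/n_j=\infty$. Let $X,Y$ be nonnegative random variables with joint distribution function $H$. Then $H$ is uniquely determined by the countably many values $\{\mathcal{L}_H(m_i,n_j): i,j\in\mathbb{N}\}$ of its Laplace–Stieltjes transform; i.e., if $(X_1,Y_1)\sim H_1$ and $(X_2,Y_2)\sim H_2$ are nonnegative random vectors with $\mathcal{L}_{H_1}(m_i,n_j)=\mathcal{L}_{H_2}(m_i,n_j)$ for all $i,j\in\mathbb{N}$, then $H_1=H_2$.
   Context: For a random vector $(X,Y)$ in $[0,\infty)^2$ with joint distribution function $H(x,y)={\bf P}(X\le x,Y\le y)$, the bivariate Laplace–Stieltjes transform is $\mathcal{L}_H(s,t)={\bf E}[\exp(-sX-tY)]$, $s,t>0$. *)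

(* Defs.v *)
From HB Require Import structures.
From mathcomp Require Import all_boot all_order all_algebra.
From mathcomp Require Import all_classical all_reals all_analysis.
Set Implicit Arguments. Unset Strict Implicit. Unset Printing Implicit Defensive.
Import Order.TTheory GRing.Theory Num.Theory.
Import numFieldNormedType.Exports.
Local Open Scope classical_set_scope.
Local Open Scope ring_scope.

Definition joint_cdf d (T : measurableType d) (R : realType)
  (P : probability T R) (X Y : {RV P >-> R}) (x y : R) : \bar R :=
  P [set w | X w <= x /\ Y w <= y].

Definition laplace2 d (T : measurableType d) (R : realType)
  (P : probability T R) (X Y : {RV P >-> R}) (s t : R) : \bar R :=
  (\int[P]_w (expR (- (s * X w + t * Y w)))%:E)%E.

(* Main.v *)
Require Import Defs.
From HB Require Import structures.
From mathcomp Require Import all_boot all_order all_algebra.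
From mathcomp Require Import all_classical all_reals all_analysis.
From mathcomp Require Import measurable_realfun ring lra.
Import Order.TTheory GRing.Theory Num.Theory.
Import numFieldNormedType.Exports.
Set Implicit Arguments. Unset Strict Implicit. Unset Printing Implicit Defensive.
Local Open Scope classical_set_scope.
Local Open Scope ring_scope.

(** Müntz's theorem, proved as by von Golitschek.  With [x = e^{-u}], the function
    [e^{-qu}] is approximated uniformly on [u >= 0] by combinations of the [e^{-p_i u}],
    [i < k], with error at most [\prod_(i < k) `|1 - q / p_i|].  Hence the difference
    of two Laplace transforms vanishing at every [m_i] vanishes at every
    [q < m_0], where the product is at most [exp (- q \sum 1/m_i)]; and once it vanishes
    on [(0, a)] it vanishes on [(0, 2a)], by using nodes [p_i] that stay
    close to [a], so that the factors stay bounded away from 1.  This covers bounded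
    and unbounded [m] alike.  Applied in each variable in turn, it shows that the transforms
    agree on all positive [(s, t)].  The joint distribution function is then a
    limit of finite combinations of values of the transform. *)

(** * Uniform approximation on the half-line by exponential sums *)

(** Both [h + g] and [h - g] have nonnegative derivative on the half-line, so neither decreases
    between 0 and [u]. *)
Lemma normr_le_derive_le (R : realType) (g h dg dh : R -> R) (u : R) :
  (forall x : R, is_derive x 1 g (dg x)) ->
  (forall x : R, is_derive x 1 h (dh x)) ->
  (forall x, 0 <= x -> `|dg x| <= dh x) ->
  0 <= u -> `|g u - g 0| <= h u - h 0.
Proof.
move=> dgE dhE le_d u0.
have incr (f df : R -> R) : (forall x : R, is_derive x 1 f (df x)) ->
    (forall x, 0 <= x -> 0 <= df x) -> f 0 <= f u.
  move=> dfE df0; have fx1 x : derivable f x 1 by case: (dfE x).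
  apply: (@ger0_derive1_le_cc _ f 0 u) => //.
  - move=> x; rewrite in_itv/= => /andP[/ltW x0 _].
    by rewrite derive1E derive_val df0.
  - by apply: derivable_within_continuous => x _.
  - by rewrite in_itv/= lexx.
  - by rewrite in_itv/= lexx u0.
have hDg := incr _ _ (fun x => is_deriveD (dhE x) (dgE x)).
have hBg := incr _ _ (fun x => is_deriveB (dhE x) (dgE x)).
rewrite ler_norml; apply/andP; split.
- have {hDg} : (h + g) 0 <= (h + g) u.
    by apply: hDg => x /le_d; rewrite ler_norml => /andP[]; lra.
  by rewrite !fctE; lra.
- have {hBg} : (h - g) 0 <= (h - g) u.
    by apply: hBg => x /le_d; rewrite ler_norml => /andP[]; lra.
  by rewrite !fctE; lra.
Qed.

Lemma is_derive_expRM (R : realType) (c x : R) :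
  is_derive x 1 (fun u => expR (c * u)) (c * expR (c * x)).
Proof.
have h : is_derive x 1 (fun u : R => c * u) c.
  by apply: is_derive_eq; rewrite scaler1.
apply: is_derive_eq.
by rewrite /GRing.scale/= mulrC.
Qed.

(** Induction on [k]: integrating the bound on [dg] from 0 and dividing by e^{ru} multiplies the
    previous error bound by at most |r - q| / r, which is the new factor. *)
Lemma expR_sum_approx (R : realType) (p : nat -> R) (q : R) (k : nat) :
  (forall i, 0 < p i) -> injective p -> 0 <= q ->
  exists a : nat -> R, forall u : R, 0 <= u ->
    `|expR (- (q * u)) - \sum_(i < k) a i * expR (- (p i * u))|
      <= \prod_(i < k) `|1 - q / p i|.
Proof.
move=> p0 pinj q0; elim: k => [|k [a IH]].
  exists (fun=> 0) => u u0; rewrite !big_ord0 subr0 ger0_norm ?expR_ge0//.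
  by rewrite -expR0 ler_expR oppr_le0 mulr_ge0.
set r := p k; set C := \prod_(i < k) _ in IH.
(* Solves (r - p_i) b_i = (r - q) a_i, which matches the derivative of [g] with the previous error
   term; injectivity of [p] keeps the denominator nonzero. *)
pose b i : R := a i * (r - q) / (r - p i).
have [c cE] : exists c : R, c = 1 - \sum_(i < k) b i by eexists.
(* With f_j the error function at step j, g is e^{ru} f_{k+1}(u), and
   g' = (r - q) e^{ru} f_k; c is chosen so that g vanishes at 0. *)
pose g u := expR ((r - q) * u) - \sum_(i < k) b i * expR ((r - p i) * u).
pose dg u := (r - q) * expR (r * u) *
  (expR (- (q * u)) - \sum_(i < k) a i * expR (- (p i * u))).
pose h u : R := C * `|r - q| / r * expR (r * u).
pose dh u : R := C * `|r - q| * expR (r * u).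
have r0 : 0 < r := p0 k.
have C0 : 0 <= C by apply: prodr_ge0 => i _.
have expB s u : expR ((r - s) * u) = expR (r * u) * expR (- (s * u)).
  by rewrite mulrBl expRD.
have dgE (x : R) : is_derive x 1 g (dg x).
  rewrite (_ : g = (fun u => expR ((r - q) * u)) -
      \sum_(i < k) (b i \*: (fun u => expR ((r - p i) * u)))); last first.
    by apply/funext => u; rewrite !fctE fct_sumE.
  have D := is_deriveB (is_derive_expRM (r - q) x)
    (is_derive_sum (fun i : 'I_k => is_deriveZ (b i) (is_derive_expRM (r - p i) x))).
  apply: is_derive_eq.
  rewrite /dg mulrBr expB mulrA mulr_sumr; congr (_ - _).
  apply: eq_bigr => i _; rewrite expB /b /GRing.scale/=.
  have : r - p i != 0.
    by rewrite subr_eq0; apply/eqP => /pinj ki; have := ltn_ord i; rewrite -ki ltnn.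
  by move=> ?; field.
have dhE (x : R) : is_derive x 1 h (dh x).
  have D := is_deriveZ (C * `|r - q| / r) (is_derive_expRM r x).
  apply: is_derive_eq.
  by rewrite /GRing.scale/= /dh; field; rewrite gt_eqF.
have le_dg x : 0 <= x -> `|dg x| <= dh x.
  move=> x0; rewrite /dg /dh !normrM (ger0_norm (expR_ge0 _)) mulrC mulrA.
  by rewrite ler_wpM2r ?expR_ge0// ler_wpM2r// IH.
exists (fun i => if (i < k)%N then b i else c) => u u0.
have := normr_le_derive_le dgE dhE le_dg u0.
rewrite !big_ord_recr/= ltnn.
under eq_bigr do rewrite ltn_ord.
have -> : g 0 = c.
  rewrite /g cE !mulr0 expR0; congr (_ - _).
  by apply: eq_bigr => i _; rewrite mulr0 expR0 mulr1.
have -> : g u - c = expR (r * u) * (expR (- (q * u)) -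
    (\sum_(i < k) b i * expR (- (p i * u)) + c * expR (- (p k * u)))).
  rewrite /g expB (mulrBr (expR (r * u))) mulrDr opprD addrA mulr_sumr.
  congr (_ - _ - _).
    by apply: eq_bigr => i _; rewrite expB; ring.
  by rewrite mulrCA -expRD subrr expR0 mulr1.
have -> : `|1 - q / p k| = `|r - q| / r.
  by rewrite -{2}(gtr0_norm r0) -normf_div mulrBl divff ?gt_eqF.
rewrite normrM (ger0_norm (expR_ge0 _)) => le_gh.
rewrite -(ler_pM2l (expR_gt0 (r * u))) (le_trans le_gh)// /h.
rewrite [leRHS]mulrC mulrA lerBlDr lerDl !mulr_ge0 ?invr_ge0 ?expR_ge0 ?(ltW r0)//.
Qed.

(** * Zeros of bounded functionals on exponentials *)

(* The functional sending e^{-su} to D s is bounded by M for the sup norm on [0, +oo[. *)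
Definition expR_bounded (R : realType) (D : R -> R) (M : R) :=
  forall n (c s : nat -> R) (C : R), (forall i, 0 <= s i) ->
    (forall u : R, 0 <= u -> `|\sum_(i < n) c i * expR (- (s i * u))| <= C) ->
    `|\sum_(i < n) c i * D (s i)| <= M * C.

(** Apply the functional to the approximation error of e^{-qu}: the nodes [p i] contribute nothing,
    so |D q| is at most M times the product, for every [k]. *)
Lemma expR_bounded_eq0 (R : realType) (D : R -> R) (M : R)
    (p : nat -> R) (q : R) :
  expR_bounded D M -> (forall i, 0 < p i) -> injective p -> 0 <= q ->
  \prod_(i < k) `|1 - q / p i| @[k --> \oo] --> 0 ->
  (forall i, D (p i) = 0) -> D q = 0.
Proof.
move=> DM p0 pinj q0 prod0 Dp.
have le_Dq k : `|D q| <= M * \prod_(i < k) `|1 - q / p i|.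
  have [a ha] := expR_sum_approx k p0 pinj q0.
  set C := \prod_(i < k) _ in ha *.
  (* Index 0 carries the target exponent [q] with coefficient 1; the nodes are shifted by one and
     enter with coefficients [- a j]. *)
  have := DM k.+1 (fun i => if i is j.+1 then - a j else 1)
    (fun i => if i is j.+1 then p j else q) C.
  rewrite big_ord_recl/= mul1r big1 ?addr0 => [|i _]; last first.
    by rewrite add0n Dp mulr0.
  apply=> [[|i]//|u u0]; first exact/ltW.
  rewrite big_ord_recl/= mul1r.
  under eq_bigr do rewrite add0n mulNr.
  by rewrite sumrN ha.
apply/eqP; rewrite -normr_le0.
have : M * \prod_(i < k) `|1 - q / p i| @[k --> \oo] --> M * 0.
  by apply: cvgMr => //; exact: cvg_cst.
rewrite mulr0; move/cvg_lim => <- //.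
apply: limr_ge; last by near=> k.
apply/cvg_ex; exists (M * 0).
by apply: cvgMr => //; exact: cvg_cst.
Unshelve. all: by end_near. Qed.

(** Since q < m_i, each factor is 1 - q/m_i itself, hence at most exp(-q/m_i). *)
Lemma cvg_prod_series_inv (R : realType) (m : nat -> R) (q : R) :
  0 < q -> (forall i, q < m i) -> [series (m i)^-1]_i @ \oo --> +oo ->
  \prod_(i < k) `|1 - q / m i| @[k --> \oo] --> 0.
Proof.
move=> q0 qm divm.
have m0 i : 0 < m i := lt_trans q0 (qm i).
have le_prod k :
    \prod_(i < k) `|1 - q / m i| <= expR (- (q * \sum_(0 <= i < k) (m i)^-1)).
  rewrite big_mkord mulr_sumr -sumrN expR_sum.
  apply: ler_prod => i _; rewrite normr_ge0/= ger0_norm ?expR_ge1Dx//.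
  by rewrite subr_ge0 ler_pdivrMr// mul1r ltW.
apply: (@squeeze_cvgr _ _ _ _ (fun=> 0)
  (fun k => expR (- (q * \sum_(0 <= i < k) (m i)^-1)))).
- by near=> k; rewrite le_prod andbT prodr_ge0.
- exact: cvg_cst.
- suff qdiv : q * \sum_(0 <= i < k) (m i)^-1 @[k --> \oo] --> +oo.
    exact: (cvg_comp _ _ qdiv (@cvgr_expR R)).
  apply/cvgryPge => A; near=> k.
  rewrite mulrC -ler_pdivrMr//; near: k.
  by move/cvgryPge: divm; apply.
Unshelve. all: by end_near. Qed.

Lemma expR_bounded_double (R : realType) (D : R -> R) (M a : R) :
  expR_bounded D M -> 0 < a -> (forall s, 0 < s < a -> D s = 0) ->
  forall s, 0 < s < 2 * a -> D s = 0.
Proof.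
move=> DM a0 Da q /andP[q0 qa2].
have [qa|aq] := ltP q a; first by rewrite Da// q0 qa.
(* The midpoint of q/2 and a. From b > q/2 comes q/b - 1 < 1, and the distinct nodes [p i] lie in
   ]b, a[, where [D] vanishes. As p_i < a <= q, each factor equals q/p_i - 1, at most q/b - 1. *)
pose b := (q / 2 + a) / 2.
pose p (i : nat) : R := b + (a - b) / i.+2%:R.
have ba : b < a by rewrite /b; lra.
have b0 : 0 < b by rewrite /b; lra.
have pb i : b < p i.
  by rewrite ltrDl divr_gt0 ?subr_gt0.
have pa i : p i < a.
  by rewrite /p -ltrBrDl ltr_pdivrMr// ltr_pMr ?subr_gt0// ltr1n.
have p0 i : 0 < p i := lt_trans b0 (pb i).
apply: (expR_bounded_eq0 DM (p := p)) => //.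
- move=> i j /addrI /mulfI; rewrite subr_eq0 gt_eqF// => /(_ isT) /invr_inj.
  by move=> /eqP; rewrite eqr_nat => /eqP[].
- exact: ltW.
- pose r := `|q / b - 1|.
  have r1 : r < 1.
    rewrite /r ltr_norml ltrBlDr ltr_pdivrMr// ltrBrDr.
    by rewrite addNr divr_gt0//= /b; lra.
  apply: (@squeeze_cvgr _ _ _ _ (fun=> 0) (fun k => r ^+ k)).
  + near=> k; rewrite prodr_ge0//= -[in leRHS](card_ord k) -prodr_const.
    apply: ler_prod => i _; rewrite normr_ge0/= distrC.
    have le1 : 1 <= q / p i.
      by rewrite ler_pdivlMr// mul1r (le_trans (ltW (pa i))).
    rewrite (le_trans _ (ler_norm _))// ger0_norm ?subr_ge0// lerD2r.
    by rewrite ler_pM2l// lef_pV2 ?posrE ?(ltW (pb i)).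
  + exact: cvg_cst.
  + by apply: cvg_expr; rewrite normr_id.
- by move=> i; rewrite Da// p0 pa.
Unshelve. all: by end_near. Qed.

(** The nodes [m] themselves give vanishing on ]0, m_0[; doubling [k] times reaches ]0, 2^k m_0[,
    and every positive [s] lies in one of these intervals. *)
Lemma expR_bounded_muntz (R : realType) (D : R -> R) (M : R) (m : nat -> R) :
  expR_bounded D M ->
  0 < m 0%N -> (forall i, m i < m i.+1) ->
  [series (m i)^-1]_i @ \oo --> +oo ->
  (forall i, D (m i) = 0) -> forall s, 0 < s -> D s = 0.
Proof.
move=> DM m0 hm divm Dm.
have incm : {mono m : i j / (i <= j)%N >-> i <= j} by exact/increasing_seqP.
have D0 s : 0 < s < m 0%N -> D s = 0.
  move=> /andP[s0 sm0].
  have sm i : s < m i by rewrite (lt_le_trans sm0)// incm.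
  apply: (expR_bounded_eq0 DM (p := m)) => //.
  - by move=> i; rewrite (lt_trans s0).
  - exact: (inc_inj incm).
  - exact: ltW.
  - exact: cvg_prod_series_inv.
have Dpow k s : 0 < s < 2 ^+ k * m 0%N -> D s = 0.
  elim: k s => [s|k IH s]; first by rewrite expr0 mul1r => /D0.
  rewrite exprS -mulrA; apply: (expR_bounded_double DM) => //.
  by rewrite mulr_gt0// exprn_gt0.
move=> s s0; have [k sk] : exists k : nat, s < 2 ^+ k * m 0%N.
  exists (Num.truncn (s / m 0%N)).+1; rewrite -ltr_pdivrMr//.
  rewrite (lt_le_trans (truncnS_gt _))// -natrX ler_nat ltnW//.
  exact: ltn_expl.
by apply: (Dpow k); rewrite s0.
Qed.

(** * The transform as a bounded functional *)

Definition laplaceR d (T : measurableType d) (R : realType)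
    (P : probability T R) (X Y : {RV P >-> R}) (s t : R) : R :=
  \int[P]_w expR (- (s * X w + t * Y w)).

Section expectation.
Context (R : realType) d (T : measurableType d) (P : probability T R).
Implicit Types (X Y : {RV P >-> R}).

Lemma integrable_bounded (f : T -> R) (M : R) :
  measurable_fun setT f -> (forall w, `|f w| <= M) ->
  P.-integrable setT (EFin \o f).
Proof.
move=> mf fM; apply: measurable_bounded_integrable => //.
  exact: fin_num_fun_lty.
exists M; split; first exact: num_real.
by move=> N /ltW MN w _; exact: le_trans (fM w) MN.
Qed.

Lemma Rintegral_sum n (F : 'I_n -> T -> R) :
  (forall i, P.-integrable setT (EFin \o F i)) ->
  \int[P]_w (\sum_(i < n) F i w) = \sum_(i < n) \int[P]_w F i w.
Proof.
elim: n F => [|n IH] F iF.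
  rewrite big_ord0 (@eq_Rintegral _ _ _ P setT (fun=> 0)); last by move=> w _; rewrite big_ord0.
  by rewrite Rintegral_cst// mul0r.
rewrite big_ord_recr/= -IH// -RintegralD//.
  by apply: eq_Rintegral => w _; rewrite big_ord_recr.
rewrite (_ : _ \o _ = (fun w => \sum_(i < n) (F (widen_ord (leqnSn n) i) w)%:E)%E).
  by apply: integrable_sum => // i _; exact: iF.
by apply/funext => w /=; rewrite sumEFin.
Qed.

Lemma measurable_expR_lin X Y (s t : R) :
  measurable_fun setT (fun w => expR (- (s * X w + t * Y w))).
Proof.
apply: measurableT_comp => //; apply: measurableT_comp => //.
by apply: measurable_funD; apply: measurable_funM.
Qed.

Lemma expR_lin_le1 X Y (s t : R) w : 0 <= X w -> 0 <= Y w -> 0 <= s -> 0 <= t ->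
  `|expR (- (s * X w + t * Y w))| <= 1.
Proof.
move=> X0 Y0 s0 t0; rewrite ger0_norm ?expR_ge0// -expR0 ler_expR oppr_le0.
by rewrite addr_ge0 ?mulr_ge0.
Qed.

Lemma integrable_expR_lin X Y (s t : R) :
  (forall w, 0 <= X w) -> (forall w, 0 <= Y w) -> 0 <= s -> 0 <= t ->
  P.-integrable setT (EFin \o fun w => expR (- (s * X w + t * Y w))).
Proof.
move=> X0 Y0 s0 t0; apply: (integrable_bounded (M := 1)).
  exact: measurable_expR_lin.
by move=> w; exact: expR_lin_le1.
Qed.

Lemma laplaceRE X Y (s t : R) : laplaceR X Y s t = fine (laplace2 X Y s t).
Proof. by []. Qed.

Lemma laplaceRC X Y (s t : R) : laplaceR X Y s t = laplaceR Y X t s.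
Proof. by apply: eq_Rintegral => w _; rewrite addrC. Qed.

(** The combination is the expectation of the exponential sum at [X], bounded by [C], times e^{-tY},
    which is at most 1; a probability has total mass 1. *)
Lemma expR_bounded_laplaceR X Y (t : R) :
  (forall w, 0 <= X w) -> (forall w, 0 <= Y w) -> 0 <= t ->
  expR_bounded (laplaceR X Y ^~ t) 1.
Proof.
move=> X0 Y0 t0 n c s C s0 hC.
have iF (i : 'I_n) :
    P.-integrable setT (EFin \o fun w => c i * expR (- (s i * X w + t * Y w))).
  apply: (integrable_bounded (M := `|c i|)).
    by apply: measurable_funM => //; exact: measurable_expR_lin.
  by move=> w; rewrite normrM ler_piMr// expR_lin_le1.
under eq_bigr do rewrite -RintegralZl ?integrable_expR_lin//.
rewrite -Rintegral_sum// mul1r.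
have iS : P.-integrable setT
    (EFin \o fun w => \sum_(i < n) c i * expR (- (s i * X w + t * Y w))).
  rewrite (_ : _ \o _ =
     (fun w => \sum_(i < n) (c i * expR (- (s i * X w + t * Y w)))%:E)%E).
    by apply: integrable_sum => // i _; exact: iF.
  by apply/funext => w /=; rewrite sumEFin.
apply: (le_trans (le_normr_Rintegral _ iS)) => //.
have -> : C = \int[P]_w C.
  by rewrite Rintegral_cst// [X in fine X](probability_setT P) mulr1.
apply: le_Rintegral => //.
- by apply: integrable_norm.
- by apply: (integrable_bounded (M := `|C|)).
move=> w _.
rewrite (eq_bigr (fun i : 'I_n => c i * expR (- (s i * X w)) * expR (- (t * Y w)))).
  rewrite -mulr_suml normrM (le_trans _ (hC _ (X0 w)))// ler_piMr//.
  by have := @expR_lin_le1 X Y 0 t w; rewrite mul0r add0r; apply.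
by move=> i _; rewrite opprD expRD mulrA.
Qed.

End expectation.

Lemma expR_boundedB (R : realType) (D1 D2 : R -> R) (M1 M2 : R) :
  expR_bounded D1 M1 -> expR_bounded D2 M2 ->
  expR_bounded (fun s => D1 s - D2 s) (M1 + M2).
Proof.
move=> h1 h2 n c s C s0 hC.
under eq_bigr do rewrite mulrBr.
by rewrite sumrB mulrDl (le_trans (ler_normB _ _))// lerD ?h1 ?h2.
Qed.

(** * Exponential sums converging to the indicator of [0, x] *)

Definition cdf_exponent (R : realType) (x : R) (n : nat) : nat :=
  (n.+1 * (Num.truncn (expR (n.+1%:R * x))).+1)%N.

(* (1 - e^{-Nu})^K behaves like exp(- K e^{-Nu}); the exponent K, of order N e^{Nx},
   makes it tend to 0 for u <= x, the extra factor N taking care of u = x, and to 1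
   for u > x. *)
Definition cdf_kernel (R : realType) (x : R) (n : nat) (u : R) : R :=
  1 - (1 - expR (- (n.+1%:R * u))) ^+ cdf_exponent x n.

Lemma bernoulli_ge (R : realType) (v : R) (k : nat) :
  0 <= v <= 1 -> 1 - k%:R * v <= (1 - v) ^+ k.
Proof.
move=> /andP[v0 v1]; elim: k => [|k IH]; first by rewrite mul0r subr0.
rewrite exprS; apply: (@le_trans _ _ ((1 - v) * (1 - k%:R * v))).
  have : 0 <= k%:R * v ^+ 2 :> R by rewrite mulr_ge0// sqr_ge0.
  by rewrite -[k.+1]addn1 natrD; lra.
by rewrite ler_wpM2l// subr_ge0.
Qed.

Lemma cdf_kernel_itv (R : realType) (x : R) n (u : R) :
  0 <= u -> 0 <= cdf_kernel x n u <= 1.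
Proof.
move=> u0; have v1 : expR (- (n.+1%:R * u)) <= 1.
  by rewrite -expR0 ler_expR oppr_le0 mulr_ge0.
rewrite /cdf_kernel subr_ge0 exprn_ile1 ?subr_ge0// ?gerBl ?expR_ge0//=.
by rewrite exprn_ge0// subr_ge0.
Qed.

Lemma cvg_cdf_kernel (R : realType) (x u : R) : 0 <= x -> 0 <= u ->
  cdf_kernel x n u @[n --> \oo] --> ((u <= x)%R%:R : R).
Proof.
move=> x0 u0.
have v01 n : 0 <= expR (- (n.+1%:R * u)) <= 1.
  by rewrite expR_ge0 -expR0 ler_expR oppr_le0 mulr_ge0.
have [ux|xu] := leP u x.
  rewrite -[X in _ --> X]subr0; apply: cvgB; first exact: cvg_cst.
  (* With N = n + 1 and v = e^{-Nu}, the exponent K satisfies Kv >= N, so (1 - v)^K <= e^{-Kv} <=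
     1/N. *)
  apply: (@squeeze_cvgr _ _ _ _ (fun=> 0) harmonic).
  - near=> n; have /andP[v0 v1] := v01 n.
    rewrite exprn_ge0 ?subr_ge0//=.
    set v := expR _ in v0 v1 *; set K := cdf_exponent x n.
    have NvK : n.+1%:R <= v * K%:R.
      rewrite natrM mulrCA ler_peMr// mulrC -ler_pdivrMr ?expR_gt0// -expRN opprK mul1r.
      by rewrite (le_trans _ (ltW (truncnS_gt _)))// ler_expR ler_pM2l.
    have vK : (1 - v) ^+ K <= expR (- (v * K%:R)).
      rewrite -mulNr expRM_natr lerXn2r ?nnegrE ?subr_ge0 ?expR_ge0//.
      exact: expR_ge1Dx.
    apply: (le_trans vK); rewrite expRN /harmonic/= lef_pV2 ?posrE ?expR_gt0//.
    by rewrite (le_trans NvK)// (le_trans _ (expR_ge1Dx _))// lerDr.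
  - exact: cvg_cst.
  - exact: cvg_harmonic.
pose e := u - x; have e0 : 0 < e by rewrite subr_gt0.
(* Bernoulli's inequality bounds the kernel by K e^{-Nu} <= 2N e^{-Ne}; then e^{Ne} >= (Ne/2)^2
   turns this into 8 / (e^2 N). *)
apply: (@squeeze_cvgr _ _ _ _ (fun=> 0) (fun n => 8 / e ^+ 2 * harmonic n)).
- near=> n; have /andP[-> _]/= := cdf_kernel_itv x n u0.
  rewrite /cdf_kernel lerBlDl -lerBlDr (le_trans _ (bernoulli_ge _ (v01 n)))//.
  rewrite lerB// /cdf_exponent natrM /harmonic/=.
  set N : R := n.+1%:R; have N0 : 0 < N by [].
  set T : R := _.+1%:R.
  have T2 : T <= 2 * expR (N * x).
    have Nx1 : 1 <= expR (N * x) by rewrite -expR0 ler_expR mulr_ge0// ltW.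
    rewrite /T -addn1 natrD mulr2n mulrDl mul1r lerD//.
    by rewrite truncn_le expR_ge0.
  have exp_ge : (N * e / 2) ^+ 2 <= expR (N * e).
    rewrite [X in _ <= expR X](_ : _ = N * e / 2 * 2%:R); last by field.
    rewrite expRM_natr lerXn2r ?nnegrE ?expR_ge0//.
      by rewrite divr_ge0// mulr_ge0// ltW.
    by rewrite (le_trans _ (expR_ge1Dx _))// lerDr.
  apply: (@le_trans _ _ (2 * N / expR (N * e))).
    rewrite (_ : 2 * N / _ = N * (2 * expR (N * x)) * expR (- (N * u))).
      by rewrite ler_wpM2r ?expR_ge0// ler_wpM2l// ltW.
    by rewrite /e mulrBr expRD !expRN invfM invrK; ring.
  rewrite ler_pdivrMr ?expR_gt0//.
  apply: (@le_trans _ _ (8 / e ^+ 2 / N * (N * e / 2) ^+ 2)).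
    by rewrite le_eqVlt; apply/orP; left; apply/eqP; field; rewrite !gt_eqF.
  by rewrite ler_wpM2l// !mulr_ge0// invr_ge0 ltW// exprn_gt0.
- exact: cvg_cst.
- rewrite -[X in _ --> X](mulr0 (8 / e ^+ 2)).
  by apply: cvgMr => //; exact: cvg_harmonic.
Unshelve. all: by end_near. Qed.

(** Binomial coefficients of the kernel, shifted by one: the constant term of the power cancels the
    leading 1, so only strictly positive exponents N(i + 1) occur, where the transforms are known to
    agree. *)
Definition cdf_coef (R : realType) (x : R) (n i : nat) : R :=
  - ((-1) ^+ i.+1 *+ 'C(cdf_exponent x n, i.+1)).

Lemma cdf_kernelE (R : realType) (x : R) n (u : R) :
  cdf_kernel x n u = \sum_(i < cdf_exponent x n)
    cdf_coef x n i * expR (- (n.+1%:R * i.+1%:R * u)).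
Proof.
rewrite /cdf_kernel exprBn big_ord_recl/= !expr0 bin0 mul1r expr1n mulr1.
rewrite opprD addrA subrr sub0r -sumrN; apply: eq_bigr => i _.
have -> : - (n.+1%:R * i.+1%:R * u) = - (n.+1%:R * u) * i.+1%:R by ring.
rewrite /bump/= add1n /cdf_coef expr1n mulr1 expRM_natr [RHS]mulNr.
by congr (- _); rewrite [RHS]mulrnAl.
Qed.

(** * The joint distribution function as a limit of transform values *)

Section joint_cdf_limit.
Context (R : realType) d (T : measurableType d) (P : probability T R).
Variables X Y : {RV P >-> R}.
Hypotheses (X0 : forall w, 0 <= X w) (Y0 : forall w, 0 <= Y w).

Let kernel2 (x y : R) n w := cdf_kernel x n (X w) * cdf_kernel y n (Y w).

Let kernel2_itv x y n w : 0 <= kernel2 x y n w <= 1.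
Proof.
have /andP[k0 k1] := cdf_kernel_itv x n (X0 w).
have /andP[l0 l1] := cdf_kernel_itv y n (Y0 w).
by rewrite mulr_ge0//= mulr_ile1.
Qed.

Let measurable_kernel2 x y n : measurable_fun setT (kernel2 x y n).
Proof.
have mk (Z : {RV P >-> R}) z : measurable_fun setT (fun w => cdf_kernel z n (Z w)).
  apply: measurable_funB => //; apply: measurable_funX.
  apply: measurable_funB => //; apply: measurableT_comp => //.
  by apply: measurableT_comp => //; apply: measurable_funM.
by apply: measurable_funM; exact: mk.
Qed.

Lemma Rintegral_cdf_kernel2 (x y : R) n :
  \int[P]_w (cdf_kernel x n (X w) * cdf_kernel y n (Y w)) =
  \sum_(i < cdf_exponent x n) \sum_(j < cdf_exponent y n)
    cdf_coef x n i * cdf_coef y n j *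
    laplaceR X Y (n.+1%:R * i.+1%:R) (n.+1%:R * j.+1%:R).
Proof.
pose F i j w := cdf_coef x n i * cdf_coef y n j *
  expR (- (n.+1%:R * i.+1%:R * X w + n.+1%:R * j.+1%:R * Y w)).
have iE i j : P.-integrable setT
    (EFin \o fun w => expR (- (n.+1%:R * i.+1%:R * X w + n.+1%:R * j.+1%:R * Y w))).
  by apply: integrable_expR_lin => //; rewrite mulr_ge0.
have iF i j : P.-integrable setT (EFin \o F i j).
  rewrite (_ : _ \o _ = (fun w => (cdf_coef x n i * cdf_coef y n j)%:E *
    (expR (- (n.+1%:R * i.+1%:R * X w + n.+1%:R * j.+1%:R * Y w)))%:E)%E).
    by apply: integrableZl => //; exact: iE.
  by apply/funext => w.
have iS i : P.-integrable setT (EFin \o fun w => \sum_(j < cdf_exponent y n) F i j w).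
  rewrite (_ : _ \o _ = (fun w => \sum_(j < cdf_exponent y n) (F i j w)%:E)%E).
    by apply: integrable_sum => // j _; exact: iF.
  by apply/funext => w /=; rewrite sumEFin.
transitivity (\int[P]_w \sum_(i < cdf_exponent x n)
    \sum_(j < cdf_exponent y n) F i j w).
  apply: eq_Rintegral => w _; rewrite !cdf_kernelE mulr_suml.
  apply: eq_bigr => i _; rewrite mulr_sumr; apply: eq_bigr => j _.
  by rewrite /F opprD expRD; ring.
rewrite Rintegral_sum//; apply: eq_bigr => i _.
rewrite Rintegral_sum//; apply: eq_bigr => j _.
by rewrite RintegralZl.
Qed.

(** Dominated convergence with bound 1. The kernels converge to the closed indicators even at the
    endpoints, so no continuity of the distribution function at (x, y) is required. *)
Lemma cvg_joint_cdf (x y : R) : 0 <= x -> 0 <= y ->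
  (\int[P]_w (cdf_kernel x n (X w) * cdf_kernel y n (Y w)))%:E @[n --> \oo]
    --> joint_cdf X Y x y.
Proof.
move=> x0 y0.
have ik n : P.-integrable setT (EFin \o kernel2 x y n).
  apply: (@integrable_bounded _ _ _ _ _ 1) => // w.
  by have /andP[k0 k1] := kernel2_itv x y n w; rewrite ger0_norm.
pose A := [set w | X w <= x /\ Y w <= y].
have mA : measurable A.
  rewrite (_ : A = X @^-1` `]-oo, x] `&` Y @^-1` `]-oo, y]).
    by apply: measurableI; exact: measurable_funPTI.
  by apply/seteqP; split => w /=; rewrite !in_itv.
have -> : joint_cdf X Y x y = (\int[P]_w (\1_A w)%:E)%E.
  by rewrite integral_indic// setIT.
rewrite (_ : (fun n => _) = (fun n => \int[P]_w (kernel2 x y n w)%:E)%E); last first.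
  apply/funext => n; rewrite /Rintegral fineK//; exact: integrable_fin_num (ik n).
apply: (@dominated_cvg _ _ _ _ _ _ _ _ (cst 1%E)) => //.
- by move=> n; apply/measurable_EFinP.
- move=> w _; apply: cvg_EFin; first by near=> n.
  rewrite indicE (_ : w \in A = (X w <= x) && (Y w <= y)); last first.
    by apply/idP/andP; rewrite inE.
  rewrite -mulnb natrM; apply: cvgM; exact: cvg_cdf_kernel.
- exact: finite_measure_integrable_cst.
- move=> n w _ /=; have /andP[k0 k1] := kernel2_itv x y n w.
  by rewrite lee_fin ger0_norm.
Unshelve. all: by end_near. Qed.

End joint_cdf_limit.

(** Covers the arguments outside the closed quadrant, to which the limit formula does not apply. *)
Lemma joint_cdf_lt0 (R : realType) d (T : measurableType d) (P : probability T R)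
    (X Y : {RV P >-> R}) (x y : R) :
  (forall w, 0 <= X w) -> (forall w, 0 <= Y w) -> (x < 0) || (y < 0) ->
  joint_cdf X Y x y = 0%E.
Proof.
move=> X0 Y0 xy0; rewrite /joint_cdf (_ : [set _ | _] = set0) ?measure0//.
apply/seteqP; split => w //= [Xx Yy].
by case/orP: xy0; rewrite ltNge ?(le_trans (X0 w) Xx) ?(le_trans (Y0 w) Yy).
Qed.

Theorem theorem3 (R : realType) (m n : nat -> R)
  (hm0 : 0 < m 0%N) (hm : forall i, m i < m i.+1)
  (hmdiv : [series (m i)^-1]_i @ \oo --> +oo)
  (hn0 : 0 < n 0%N) (hn : forall j, n j < n j.+1)
  (hndiv : [series (n j)^-1]_j @ \oo --> +oo)
  (d1 : measure_display) (T1 : measurableType d1) (P1 : probability T1 R)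
  (X1 Y1 : {RV P1 >-> R})
  (d2 : measure_display) (T2 : measurableType d2) (P2 : probability T2 R)
  (X2 Y2 : {RV P2 >-> R})
  (hX1 : forall w, 0 <= X1 w) (hY1 : forall w, 0 <= Y1 w)
  (hX2 : forall w, 0 <= X2 w) (hY2 : forall w, 0 <= Y2 w)
  (hL : forall i j, laplace2 X1 Y1 (m i) (n j) = laplace2 X2 Y2 (m i) (n j)) :
  forall x y : R, joint_cdf X1 Y1 x y = joint_cdf X2 Y2 x y.
Proof.
have n0 j : 0 < n j by elim: j => // j /lt_trans; apply.
(* First variable, with the second frozen at [n j]: the difference of the transforms is a functional
   bounded by 1 + 1 that vanishes at every [m i]. *)
have eqL1 j s : 0 < s -> laplaceR X1 Y1 s (n j) = laplaceR X2 Y2 s (n j).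
  move=> s0; apply/eqP; rewrite -subr_eq0; apply/eqP; move: s s0.
  apply: (expR_bounded_muntz (m := m)) => //.
    by apply: expR_boundedB; apply: expR_bounded_laplaceR => //; exact: ltW.
  by move=> i; rewrite !laplaceRE hL subrr.
have eqL s t : 0 < s -> 0 < t -> laplaceR X1 Y1 s t = laplaceR X2 Y2 s t.
  (* Exchanging [X] and [Y] makes [t] the first variable, so the same argument runs with the nodes
     [n] and an arbitrary s > 0. *)
  move=> s0 t0; rewrite (laplaceRC X1) (laplaceRC X2).
  apply/eqP; rewrite -subr_eq0; apply/eqP; move: t t0.
  apply: (expR_bounded_muntz (m := n)) => //.
    by apply: expR_boundedB; apply: expR_bounded_laplaceR => //; exact: ltW.
  by move=> j; rewrite (laplaceRC Y1) (laplaceRC Y2) eqL1// subrr.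
move=> x y; have [x0|x0] := ltP x 0; first by rewrite !joint_cdf_lt0 ?x0.
have [y0|y0] := ltP y 0; first by rewrite !joint_cdf_lt0 ?y0 ?orbT.
(* Both distribution functions are limits of the same sequence, because the kernel integrals are
   equal finite combinations of transform values at positive points. *)
apply: (cvg_unique _ (cvg_joint_cdf hX1 hY1 x0 y0)) => //.
rewrite (_ : (fun k => _) = (fun k =>
    (\int[P2]_w (cdf_kernel x k (X2 w) * cdf_kernel y k (Y2 w)))%:E)); last first.
  apply/funext => k; rewrite !Rintegral_cdf_kernel2//; congr EFin.
  by do 2!apply: eq_bigr => ? _; rewrite eqL// mulr_gt0.
exact: cvg_joint_cdf.
Qed.
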